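(* Let $V$ be an infinite dimensional vector space over a field $K$. Denote by $\mathcal{L}(V)$ the lattice of all subspaces of $V$. Then $M_4 \otimes \mathcal{L}(V)$ is not a lattice.
   Context: $M_4$ is the lattice of height $2$ with exactly four atoms (so it has six elements: least element, greatest element, and four pairwise incomparable atoms). Tensor products: let $A$ and $B$ be $\{\vee,0\}$-semilattices. A bi-ideal of $A\times B$ is a subset $I\subseteq A\times B$ such that: $I$ is hereditary (downward closed in the componentwise order); $I$ contains $\nabla_{A,B}=(A\times\{0\})\cup(\{0\}\times B)$; if $\langle a_0,b\rangle,\langle a_1,b\rangle\in I$ then $\langle a_0\vee a_1,b\rangle\in I$; if $\langle a,b_0\rangle,\langle a,b_1\rangle\in I$ then $\langle a,b_0\vee b_1\rangle\in I$. The bi-ideals, ordered by inclusion, form an algebraic lattice, and the tensor product $A\otimes B$ is the $\{\vee,0\}$-subsemilattice of its compact elements. Saying that $A\otimes B$ is a lattice means that this poset is a lattice. *)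

(* Defs.v *)
From HB Require Import structures.
From mathcomp Require Import all_boot all_order all_algebra.
From mathcomp Require Import all_classical.

Set Implicit Arguments.
Unset Strict Implicit.
Unset Printing Implicit Defensive.

Import Order.TTheory GRing.Theory.

Local Open Scope classical_set_scope.
Local Open Scope order_scope.

Definition is_lattice d (T : porderType d) : Prop :=
  forall x y : T,
    supremums [set x; y] !=set0 /\ infimums [set x; y] !=set0.

(* Meant for complete lattices, in which every supremum exists. *)
Definition compact_element d (L : porderType d) (x : L) : Prop :=
  forall (S : set L) (s : L), supremums S s -> x <= s ->
    exists F : set L, [/\ finite_set F, F `<=` S &
      exists2 t, supremums F t & x <= t].

Section Tensor.
Context {dA dB : Order.disp_t}.
Variables (A : bJoinSemilatticeType dA) (B : bJoinSemilatticeType dB).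

(* The pairs are compared componentwise. *)
Definition is_bi_ideal (I : set (A * B)) : Prop :=
  [/\ forall a a' b b', a' <= a -> b' <= b -> I (a, b) -> I (a', b'),
      (forall a, I (a, \bot)) /\ (forall b, I (\bot, b)),
      forall a0 a1 b, I (a0, b) -> I (a1, b) -> I (a0 `|` a1, b)
    & forall a b0 b1, I (a, b0) -> I (a, b1) -> I (a, b0 `|` b1)].

Record bi_ideal := BiIdeal {
  bi_ideal_set :> set (A * B);
  bi_idealP : `[< is_bi_ideal bi_ideal_set >] }.

HB.instance Definition _ := [isSub for bi_ideal_set].
HB.instance Definition _ := [Choice of bi_ideal by <:].
(* The order is inherited from the inclusion order of [set (A * B)]. *)
HB.instance Definition _ :=
  [SubChoice_isSubPOrder of bi_ideal by <: with (Order.Disp tt tt)].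

Record tensor := Tensor {
  tensor_bi_ideal :> bi_ideal;
  tensorP : `[< compact_element tensor_bi_ideal >] }.

HB.instance Definition _ := [isSub for tensor_bi_ideal].
HB.instance Definition _ := [Choice of tensor by <:].
HB.instance Definition _ :=
  [SubChoice_isSubPOrder of tensor by <: with (Order.Disp tt tt)].

End Tensor.

Variant M4 := M4bot | M4atom of 'I_4 | M4top.

Definition M4_code (x : M4) : option (option 'I_4) :=
  match x with
  | M4bot => None | M4atom i => Some (Some i) | M4top => Some None
  end.

Definition M4_decode (x : option (option 'I_4)) : M4 :=
  match x with
  | None => M4bot | Some (Some i) => M4atom i | Some None => M4top
  end.

Lemma M4_codeK : cancel M4_code M4_decode.
Proof. by case. Qed.

HB.instance Definition _ := Finite.copy M4 (can_type M4_codeK).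

Definition M4_le (x y : M4) : bool :=
  match x, y with
  | M4bot, _ | _, M4top => true
  | M4atom i, M4atom j => i == j
  | _, _ => false
  end.

Definition M4_meet (x y : M4) : M4 :=
  match x, y with
  | M4top, z | z, M4top => z
  | M4atom i, M4atom j => if i == j then M4atom i else M4bot
  | _, _ => M4bot
  end.

Definition M4_join (x y : M4) : M4 :=
  match x, y with
  | M4bot, z | z, M4bot => z
  | M4atom i, M4atom j => if i == j then M4atom i else M4top
  | _, _ => M4top
  end.

Lemma M4_le_refl : reflexive M4_le.
Proof. by case=> //= i. Qed.

Lemma M4_le_anti : antisymmetric M4_le.
Proof. by case=> [|i|] [|j|] //= /andP[/eqP->]. Qed.

Lemma M4_le_trans : transitive M4_le.
Proof. by case=> [|i|] [|j|] [|k|] //= /eqP->. Qed.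

HB.instance Definition _ := Order.Le_isPOrder.Build (Order.Disp tt tt) M4
  M4_le_refl M4_le_anti M4_le_trans.

Lemma M4_lexI (x y z : M4) : (x <= M4_meet y z) = (x <= y) && (x <= z).
Proof.
rewrite /Order.le /=.
case: x y z => [|i|] [|j|] [|k|] //=; rewrite ?andbT ?andbF //.
- case: (eqVneq j k) => [->|/negPf ne_jk] /=; first by rewrite andbb.
  by case: eqP => // ->; rewrite ne_jk.
- by case: (eqVneq j k).
Qed.

Lemma M4_leUx (x y z : M4) : (M4_join x y <= z) = (x <= z) && (y <= z).
Proof.
rewrite /Order.le /=.
case: x y z => [|i|] [|j|] [|k|] //=; rewrite ?andbT ?andbF //.
- by case: (eqVneq i j).
- case: (eqVneq i j) => [->|/negPf ne_ij] /=; first by rewrite andbb.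
  by case: eqP => // <-; rewrite eq_sym ne_ij.
- by case: (eqVneq i j).
Qed.

HB.instance Definition _ :=
  Order.POrder_MeetJoin_isLattice.Build (Order.Disp tt tt) M4 M4_lexI M4_leUx.

Lemma M4_le0x (x : M4) : M4bot <= x. Proof. by []. Qed.
Lemma M4_lex1 (x : M4) : x <= M4top. Proof. by case: x. Qed.

HB.instance Definition _ := Order.hasBottom.Build (Order.Disp tt tt) M4 M4_le0x.
HB.instance Definition _ := Order.hasTop.Build (Order.Disp tt tt) M4 M4_lex1.

Section Subspaces.
Local Open Scope ring_scope.
Context {K : fieldType}.
Variable V : lmodType K.

Definition finite_dimensional : Prop :=
  exists (n : nat) (e : 'I_n -> V),
    forall v, exists c : 'I_n -> K, v = \sum_(i < n) c i *: e i.

Record subspace := Subspace {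
  subspace_set :> set V;
  subspaceP : `[< submod_closed [in subspace_set] >] }.

HB.instance Definition _ := [isSub for subspace_set].
HB.instance Definition _ := [Choice of subspace by <:].
HB.instance Definition _ :=
  [SubChoice_isSubPOrder of subspace by <: with (Order.Disp tt tt)].

Implicit Types U W X : subspace.

Lemma subspace_le U W : (U <= W)%O <-> U `<=` W.
Proof. by rewrite leEsub subsetEset. Qed.

Lemma subspace_closedP (S : set V) : submod_closed [in S] <->
  S 0 /\ forall (a : K) u v, S u -> S v -> S (a *: u + v).
Proof.
have inS v : v \in [in S] <-> S v by split=> /asboolP.
split=> -[S0 Slin]; split; first exact/inS.
- by move=> a u v /inS Su /inS Sv; apply/inS/Slin.
- exact/inS.
- by move=> a u v /inS Su /inS Sv; apply/inS/Slin.
Qed.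

Lemma subspace0 U : (U : set V) 0.
Proof. by case: U => S /= /asboolP/subspace_closedP[]. Qed.

Lemma subspace_lin U (a : K) u v :
  (U : set V) u -> (U : set V) v -> (U : set V) (a *: u + v).
Proof. by case: U => S /= /asboolP/subspace_closedP[_]; apply. Qed.

Lemma subspace_zero_subproof : `[< submod_closed [in [set 0 : V]] >].
Proof.
apply/asboolP/subspace_closedP; split=> // a u v -> ->.
by rewrite scaler0 addr0.
Qed.

Definition subspace_zero := Subspace subspace_zero_subproof.

Lemma subspace_full_subproof : `[< submod_closed [in [set: V]] >].
Proof. exact/asboolP/subspace_closedP. Qed.

Definition subspace_full := Subspace subspace_full_subproof.

Lemma subspace_cap_subproof U W : `[< submod_closed [in (U `&` W)%classic] >].
Proof.
apply/asboolP/subspace_closedP; split; first by split; exact: subspace0.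
by move=> a u v [Uu Wu] [Uv Wv]; split; exact: subspace_lin.
Qed.

Definition subspace_cap U W := Subspace (subspace_cap_subproof U W).

Lemma subspace_add_subproof U W :
  `[< submod_closed [in [set u + w | u in U & w in W]] >].
Proof.
apply/asboolP/subspace_closedP; split.
  by exists 0; [exact: subspace0|exists 0; [exact: subspace0|rewrite addr0]].
move=> a _ _ [u Uu [w Ww <-]] [u' Uu' [w' Ww' <-]].
exists (a *: u + u'); first exact: subspace_lin.
exists (a *: w + w'); first exact: subspace_lin.
by rewrite scalerDr addrACA.
Qed.

Definition subspace_add U W := Subspace (subspace_add_subproof U W).

Lemma subspace_lexI X U W :
  (X <= subspace_cap U W)%O = (X <= U)%O && (X <= W)%O.
Proof.
apply/idP/andP => [/subspace_le sX|[/subspace_le sU /subspace_le sW]].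
  by split; apply/subspace_le => x /sX[].
by apply/subspace_le => x Xx; split; [exact: sU|exact: sW].
Qed.

Lemma subspace_leUx U W X :
  (subspace_add U W <= X)%O = (U <= X)%O && (W <= X)%O.
Proof.
apply/idP/andP => [/subspace_le sX|[/subspace_le sU /subspace_le sW]].
  split; apply/subspace_le => x Hx; apply: sX.
    by exists x => //; exists 0; [exact: subspace0|rewrite addr0].
  by exists 0; [exact: subspace0|exists x => //; rewrite add0r].
apply/subspace_le => _ [u /sU Xu [w /sW Xw <-]].
by rewrite -[u]scale1r; exact: subspace_lin.
Qed.

HB.instance Definition _ := Order.POrder_MeetJoin_isLattice.Build
  (Order.Disp tt tt) subspace subspace_lexI subspace_leUx.

Lemma subspace_le0x U : (subspace_zero <= U)%O.
Proof. by apply/subspace_le => _ ->; exact: subspace0. Qed.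

Lemma subspace_lex1 U : (U <= subspace_full)%O.
Proof. exact/subspace_le. Qed.

HB.instance Definition _ :=
  Order.hasBottom.Build (Order.Disp tt tt) subspace subspace_le0x.
HB.instance Definition _ :=
  Order.hasTop.Build (Order.Disp tt tt) subspace subspace_lex1.

End Subspaces.

(* Main.v *)
From HB Require Import structures.
Require Import Defs.
From mathcomp Require Import all_boot all_order all_algebra all_classical.

(** A bi-ideal of [M4 * B] amounts to four ideals of [B], one for each atom,
    whose pairwise intersections are all the same ideal, the one attached to the
    top.  To generate such a family from four elements of [B] one adds to each
    of them all the pairwise meets, and repeats.  In [B = subspace V] with [V]
    infinite dimensional this process can go on forever.

    Transport the question to polynomials along an injective linear map
    [phi : {poly K} -> V].  Take the four subspaces of polynomials [p] such that
    [p`_k = c * p`_k.+1] for all [k] of parity [b], for the four values of the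
    booleans [b] and [c]; for example [c = 0] gives the even and the odd
    polynomials.  Let [low n] be the space of polynomials of degree less than
    [n].  The process started at these four spaces has [low n] as its [n]-th
    common intersection: the sums of [low n] with the two spaces of parity
    [b = ~~ odd n] both contain ['X^n] ([low_sub_add]), while no two of the
    spaces meet modulo [low n] outside [low n.+1] ([slice_cap]).

    Let [H] be the bi-ideal generated by the four spaces; it is compact
    ([bi_span_compact]).  The lower bound shows that [low n] is in the row of
    [H] at every atom ([slices_span_low]), the upper bound that every element of
    the row at an atom is below the corresponding space enlarged by some [low n]
    ([slices_span_le_level]).  These enlarged spaces never contain all the
    [low n], so the row is an ideal without a greatest element.

    Such a row obstructs meets ([lattice_row_stable]).  Fix an atom [a].  A
    compact bi-ideal below both [H] and the pure tensor of [a] and the whole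
    space lies below a single pure tensor of [a] and one of the enlarged spaces,
    whereas a greatest lower bound would have to contain the whole row. *)

Set Implicit Arguments.
Unset Strict Implicit.
Unset Printing Implicit Defensive.

Import Order.TTheory GRing.Theory.

Local Open Scope classical_set_scope.
Local Open Scope order_scope.

Local Notation "z \In I" := ((I : set _) z) (at level 70).

(** * Bi-ideals and compactness *)

Section BiIdeals.
Context {dA dB : Order.disp_t}.
Variables (A : bJoinSemilatticeType dA) (B : bJoinSemilatticeType dB).
Implicit Types (I J : bi_ideal A B) (X : set (A * B)).

Lemma bi_ideal_le I J : I <= J <-> I `<=` J.
Proof. by rewrite -Order.le_val subsetEset. Qed.

Lemma bi_ideal_spec I : is_bi_ideal I.
Proof. exact/asboolP/bi_idealP. Qed.

Lemma bi_ideal_down I a a' b b' : a' <= a -> b' <= b ->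
  (a, b) \In I -> (a', b') \In I.
Proof. by case: (bi_ideal_spec I) => h _ _ _; apply: h. Qed.

Lemma bi_ideal_joinl I a0 a1 b : (a0, b) \In I -> (a1, b) \In I ->
  (a0 `|` a1, b) \In I.
Proof. by case: (bi_ideal_spec I) => _ _ h _; apply: h. Qed.

Lemma bi_ideal_joinr I a b0 b1 : (a, b0) \In I -> (a, b1) \In I ->
  (a, b0 `|` b1) \In I.
Proof. by case: (bi_ideal_spec I) => _ _ _; apply. Qed.

Lemma bi_span_subproof X :
  `[< is_bi_ideal [set z | forall I, X `<=` I -> z \In I] >].
Proof.
apply/asboolP; split.
- by move=> a a' b b' la lb h I XI; apply: bi_ideal_down la lb (h I XI).
- by split=> x I _; case: (bi_ideal_spec I) => _ [h0 h1] _ _.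
- by move=> a0 a1 b h0 h1 I XI; apply: bi_ideal_joinl; [exact: h0|exact: h1].
- by move=> a b0 b1 h0 h1 I XI; apply: bi_ideal_joinr; [exact: h0|exact: h1].
Qed.

Definition bi_span X : bi_ideal A B := BiIdeal (bi_span_subproof X).

Lemma bi_span_sub X : X `<=` bi_span X.
Proof. by move=> z Xz I; apply. Qed.

Lemma bi_span_le X I : bi_span X <= I <-> X `<=` I.
Proof.
split=> [/bi_ideal_le h z Xz|h]; first exact/h/bi_span_sub.
by apply/bi_ideal_le => z; apply.
Qed.

Lemma bi_span_mono X Y : X `<=` Y -> bi_span X <= bi_span Y.
Proof. by move=> XY; apply/bi_span_le => z /XY; exact: bi_span_sub. Qed.

Lemma supremum_bi_span (S : set (bi_ideal A B)) :
  supremums S (bi_span (\bigcup_(I in S) (I : set (A * B)))).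
Proof.
split=> [I SI|J ubJ].
  by apply/bi_ideal_le => z Iz; apply: bi_span_sub; exists I.
by apply/bi_span_le => z [I SI]; move: z; apply/bi_ideal_le/ubJ.
Qed.

(** The elements of [A * B] that lie in the span of the union of finitely many
    members of [S] form a bi-ideal, because two finite subfamilies can be
    merged.  It is an upper bound of [S], hence contains the supremum; so each
    generator of [bi_span X] already needs only finitely many members of [S]. *)
Lemma bi_span_compact X : finite_set X -> compact_element (bi_span X).
Proof.
move=> finX S s [ubs lubs] Xs.
pose U (F : set (bi_ideal A B)) := \bigcup_(I in F) (I : set (A * B)).
pose D : set (A * B) := [set z | exists F : set (bi_ideal A B),
  [/\ finite_set F, F `<=` S & z \In bi_span (U F)]].
have DU F G : F `<=` G -> bi_span (U F) `<=` bi_span (U G).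
  move=> FG; apply/bi_ideal_le/bi_span_mono => w [I FI Iw].
  by exists I; first exact: FG.
have D_bi : is_bi_ideal D.
  have join2 F G : finite_set F -> finite_set G -> F `<=` S -> G `<=` S ->
      finite_set (F `|` G) /\ F `|` G `<=` S.
    by move=> *; split; [rewrite finite_setU|rewrite subUset].
  split.
  - move=> a a' b b' la lb [F [fF FS h]]; exists F; split=> //.
    exact: bi_ideal_down la lb h.
  - split=> x; exists set0; split=> //;
      by case: (bi_ideal_spec (bi_span (U set0))) => _ [h0 h1] _ _.
  - move=> a0 a1 b [F [fF FS hF]] [G [fG GS hG]].
    have [fFG FGS] := join2 _ _ fF fG FS GS.
    exists (F `|` G); split=> //; apply: bi_ideal_joinl.
      by apply: DU hF; exact: subsetUl.
    by apply: DU hG; exact: subsetUr.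
  - move=> a b0 b1 [F [fF FS hF]] [G [fG GS hG]].
    have [fFG FGS] := join2 _ _ fF fG FS GS.
    exists (F `|` G); split=> //; apply: bi_ideal_joinr.
      by apply: DU hF; exact: subsetUl.
    by apply: DU hG; exact: subsetUr.
have sD : s <= BiIdeal (asboolT D_bi).
  apply: lubs => I SI; apply/bi_ideal_le => z Iz.
  exists [set I]; split; [exact: finite_set1|by move=> _ ->|].
  by apply: bi_span_sub; exists I.
have /choice[F hF] z : exists F : set (bi_ideal A B),
    X z -> [/\ finite_set F, F `<=` S & z \In bi_span (U F)].
  have [Xz|nXz] := pselect (X z); last by exists set0.
  have /bi_span_le/(_ _ Xz)[F hF] := le_trans Xs sD.
  by exists F.
pose G := \bigcup_(z in X) F z.
exists G; split.
- by apply: bigcup_finite => // z /hF[].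
- by move=> I [z /hF[_ FS _] /FS].
- exists (bi_span (U G)); first exact: supremum_bi_span.
  apply/bi_span_le => z Xz; have [_ _ h] := hF z Xz.
  by apply: DU h => I FI; exists z.
Qed.

(** The supremum of a family of bi-ideals is in general larger than the union;
    a compact bi-ideal inside the union is caught by finitely many terms, and
    the terms of a chain have a largest one among finitely many. *)
Lemma compact_chain (C : nat -> bi_ideal A B) I :
  {homo C : n m / (n <= m)%N >-> n <= m} -> compact_element I ->
  (forall z, z \In I -> exists n, z \In C n) -> exists n, I <= C n.
Proof.
move=> Cmono cI IC.
have [F [finF FS [t [_ lubt] It]]] : exists F : set (bi_ideal A B),
    [/\ finite_set F, F `<=` range C & exists2 t, supremums F t & I <= t].
  apply: cI (supremum_bi_span (range C)) _; apply/bi_ideal_le => z /IC[n Cz].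
  by apply: bi_span_sub; exists (C n) => //; exists n.
have [s Fs] := (finite_seqP F).1 finF.
have {FS} : forall J, J \in s -> exists n, J <= C n.
  by move=> J Js; have [|n _ <-] := FS J; [rewrite Fs|exists n].
have {lubt} : forall J, (forall I', I' \in s -> I' <= J) -> t <= J.
  by move=> J h; apply: lubt => I'; rewrite Fs; apply: h.
move=> lubt hC.
suff [n hn] : exists n, forall J, J \in s -> J <= C n.
  by exists n; apply: le_trans It (lubt _ hn).
elim: s hC {Fs lubt} => [|J s IH] h; first by exists 0%N.
have [|n hn] := IH; first by move=> J' J's; apply: h; rewrite inE J's orbT.
have [|m hm] := h J; first by rewrite mem_head.
exists (maxn n m) => J'; rewrite inE => /orP[/eqP->|/hn J'n].
  by apply: le_trans hm (Cmono _ _ _); rewrite leq_maxr.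
by apply: le_trans J'n (Cmono _ _ _); rewrite leq_maxl.
Qed.

Lemma pure_tensor_subproof a b : `[< is_bi_ideal
  [set z : A * B | [\/ z.1 = \bot, z.2 = \bot | z.1 <= a /\ z.2 <= b]] >].
Proof.
apply/asboolP; split=> /=.
- move=> x x' y y' lx ly [x0|y0|[xa yb]].
  + by apply: Or31; apply/eqP; rewrite -lex0 -x0.
  + by apply: Or32; apply/eqP; rewrite -lex0 -y0.
  + by apply: Or33; split; [exact: le_trans xa|exact: le_trans yb].
- by split=> x; [apply: Or32|apply: Or31].
- move=> x0 x1 y [->|->|[x0a yb]]; rewrite ?join0x //.
    by move=> _; apply: Or32.
  case=> [->|->|[x1a _]]; rewrite ?joinx0; [by apply: Or33|by apply: Or32|].
  by apply: Or33; rewrite leUx x0a.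
- move=> x y0 y1 [->|->|[xa y0b]]; rewrite ?join0x //.
    by move=> _; apply: Or31.
  case=> [->|->|[_ y1b]]; rewrite ?joinx0; [by apply: Or31|by apply: Or33|].
  by apply: Or33; rewrite leUx y0b.
Qed.

Definition pure_tensor a b : bi_ideal A B := BiIdeal (pure_tensor_subproof a b).

Lemma pure_tensor_le a b I : pure_tensor a b <= I <-> (a, b) \In I.
Proof.
split=> [/bi_ideal_le|Iab]; first by apply; apply: Or33.
have [_ [I0 I1] _ _] := bi_ideal_spec I.
apply/bi_ideal_le => -[x y] [/= ->|/= ->|[/= xa yb]] //.
exact: bi_ideal_down Iab.
Qed.

Lemma pure_tensor_compact a b : compact_element (pure_tensor a b).
Proof.
suff -> : pure_tensor a b = bi_span [set (a, b)].
  exact/bi_span_compact/finite_set1.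
apply/le_anti/andP; split; first exact/pure_tensor_le/bi_span_sub.
by apply/bi_span_le => _ ->; apply/pure_tensor_le.
Qed.

Definition tensor_of I (cI : compact_element I) : tensor A B :=
  Tensor (asboolT cI).

Lemma tensor_compact (m : tensor A B) : compact_element (m : bi_ideal A B).
Proof. exact/asboolP/tensorP. Qed.

Lemma tensor_le (x y : tensor A B) :
  (x <= y) = ((x : bi_ideal A B) <= (y : bi_ideal A B)).
Proof. by rewrite -Order.le_val. Qed.

(** The meet [m] of [H] and [pure_tensor a top] lies in the union of the chain
    [pure_tensor a (u n)], because [a] is an atom: a pair of [m] is trivial or
    has first component exactly [a].  As [m] is compact, it lies in one term of
    the chain.  But [m] also contains [(a, y)] for every [y] in the row of [H]
    at [a], since [pure_tensor a y] is a compact lower bound. *)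
Lemma lattice_row_stable (H : bi_ideal A B) (a : A) (top : B) (u : nat -> B) :
    is_lattice (tensor A B) -> compact_element H ->
    a != \bot -> (forall x, x <= a -> x = \bot \/ x = a) ->
    (forall y, y <= top) ->
    {homo u : n m / (n <= m)%N >-> n <= m} ->
    (forall y, (a, y) \In H -> exists n, y <= u n) ->
  exists n, forall y, (a, y) \In H -> y <= u n.
Proof.
move=> lat cH a0 a_atom le_top umono Hu.
have [_ [m [lbm glbm]]] :=
  lat (tensor_of cH) (tensor_of (@pure_tensor_compact a top)).
have mH : (m : bi_ideal A B) <= H.
  by have := lbm (tensor_of cH) (or_introl erefl); rewrite tensor_le.
have mT : (m : bi_ideal A B) <= pure_tensor a top.
  have := lbm (tensor_of (@pure_tensor_compact a top)) (or_intror erefl).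
  by rewrite tensor_le.
have [|[x y] mxy|n mn] :=
  @compact_chain (fun n => pure_tensor a (u n)) m _ (@tensor_compact m).
- by move=> i j ij; apply/pure_tensor_le; apply: Or33; split=> //; exact: umono.
- have /bi_ideal_le/(_ _ mxy)[/= x0|/= y0|[/= xa _]] := mT.
  + by exists 0%N; apply: Or31.
  + by exists 0%N; apply: Or32.
  + have [x0|xE] := a_atom x xa; first by exists 0%N; apply: Or31.
    have /bi_ideal_le/(_ _ mxy) := mH; rewrite xE => /Hu[n yn].
    by exists n; apply: Or33.
exists n => y Hay.
have lem : tensor_of (@pure_tensor_compact a y) <= m.
  apply: glbm => z [->|->]; rewrite tensor_le /=.
    exact/pure_tensor_le.
  by apply/pure_tensor_le; apply: Or33; split=> //; exact: le_top.
have : pure_tensor a y <= pure_tensor a (u n).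
  by apply: le_trans mn; move: lem; rewrite tensor_le.
move/pure_tensor_le => [/= aE|/= ->|[]//]; last exact: le0x.
by rewrite aE eqxx in a0.
Qed.

End BiIdeals.

(** * Four spaces of polynomials *)

Section Polynomials.
Local Open Scope ring_scope.
Variable K : fieldType.
Implicit Types (p : {poly K}) (b c : bool) (n k : nat).

Lemma slice_subproof b c n : `[< submod_closed [in [set p : {poly K} |
  forall k, (n <= k)%N -> odd k = b -> p`_k = c%:R * p`_k.+1]] >].
Proof.
apply/asboolP/subspace_closedP; split=> [k _ _|a u v hu hv k nk kb] /=.
  by rewrite !coef0 mulr0.
by rewrite !coefD !coefZ hu // hv // mulrDr mulrCA.
Qed.

(** This is the sum of [slice b c 0] and of the polynomials of degree less than
    [n]; describing it by coefficients makes intersections easy to compute. *)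
Definition slice b c n : subspace {poly K} := Subspace (slice_subproof b c n).

Lemma low_subproof n :
  `[< submod_closed [in [set p : {poly K} | (size p <= n)%N]] >].
Proof.
apply/asboolP/subspace_closedP; split=> [|a u v hu hv] /=.
  by rewrite size_poly0.
rewrite (leq_trans (size_polyD _ _)) // geq_max hv andbT.
exact: leq_trans (size_scale_leq _ _) hu.
Qed.

Definition low n : subspace {poly K} := Subspace (low_subproof n).

Lemma lowP n p : p \In low n <-> forall k, (n <= k)%N -> p`_k = 0.
Proof. by split=> [/= /leq_sizeP|h]; last exact/leq_sizeP. Qed.

Lemma low_sub_slice b c n : (low n <= slice b c n)%O.
Proof.
apply/subspace_le => p /lowP pn k nk _.
by rewrite !pn ?mulr0 // (leq_trans nk).
Qed.

Lemma slice_mono b c n m : (n <= m)%N -> (slice b c n <= slice b c m)%O.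
Proof.
by move=> nm; apply/subspace_le => p h k mk; apply: h; apply: leq_trans mk.
Qed.

Lemma low_mono n m : (n <= m)%N -> (low n <= low m)%O.
Proof. by move=> nm; apply/subspace_le => p /= /leq_trans; apply. Qed.

(** Modulo polynomials of degree less than [n], two conditions [p`_k = 0] on
    both parities leave nothing; so do two conditions [p`_k = p`_k.+1], which
    make the coefficients constant from [n] on, hence zero.  A mixed pair kills
    each coefficient directly or through a neighbour.  When the neighbour is the
    preceding one, the argument starts only at [n.+1]: this is the case where
    the intersection can really grow. *)
Lemma slice_cap b c b' c' n p : (b, c) != (b', c') ->
  p \In slice b c n -> p \In slice b' c' n ->
  p \In low n.+1.
Proof.
wlog cc' : b c b' c' / (c <= c')%N => [hw ne h h'|ne h h'].
  have [cc'|/ltnW cc'] := leqP c c'; first exact: hw ne h h'.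
  by apply: hw cc' _ h' h; rewrite eq_sym.
apply/lowP => k nk; have nk' : (n <= k)%N by exact: ltnW.
have [Eb|neb] := eqVneq b b'.
  have [c0 c1] : c = false /\ c' = true.
    by move: ne cc'; rewrite Eb xpair_eqE eqxx /=; case: (c) (c') => [] [].
  have [kb|kb] := eqVneq (odd k) b; first by rewrite h // c0 mul0r.
  case: k nk nk' kb => // k nk _ kb.
  have kb' : odd k = b by move: kb; rewrite /=; case: (odd k) (b) => [] [].
  have := h' k nk; rewrite -Eb c1 mul1r => /(_ kb') <-.
  by rewrite h // c0 mul0r.
have Eb' : b' = ~~ b by case: (b) (b') neb => [] [].
case: c' cc' h' {ne} => [_|cc'] h'; last first.
  case: c cc' h => // _ h.
  have [kb|kb] := eqVneq (odd k) b; first by rewrite h // mul0r.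
  by rewrite h' ?mul0r // Eb'; case: (odd k) (b) kb => [] [].
case: c h => h; last first.
  have [kb|kb] := eqVneq (odd k) b; first by rewrite h // mul0r.
  have kb' : odd k = b' by rewrite Eb'; case: (odd k) (b) kb => [] [].
  by rewrite h' // h ?mul0r ?mulr0 //= ?kb' ?Eb' ?negbK ?leqW.
(* Both parities now propagate a coefficient to the next one. *)
have step j : (n <= j)%N -> p`_j = p`_j.+1.
  move=> nj; have [jb|jb] := eqVneq (odd j) b; first by rewrite h // mul1r.
  by rewrite h' ?mul1r // Eb'; case: (odd j) (b) jb => [] [].
have steps m : p`_k = p`_(k + m).
  elim: m => [|m ->]; rewrite ?addn0 // addnS step //.
  by rewrite (leq_trans nk') ?leq_addr.
by rewrite (steps (size p)) nth_default // leq_addl.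
Qed.

(** The witness added to [low n] is ['X^n] if [c] is false, and
    ['X^n + 'X^n.-1] (just [1] if [n = 0]) if [c] is true. *)
Lemma low_sub_add b c n : odd n != b ->
  (low n.+1 <= Order.join (low n) (slice b c 0))%O.
Proof.
move=> nb; apply/subspace_le => p /lowP pn.
pose s := \poly_(i < n.+1) ((i == n) || c && (i.+1 == n))%:R : {poly K}.
have sE k : s`_k = ((k == n) || c && (k.+1 == n))%:R.
  by rewrite coef_poly; case: ltnP => // nk; rewrite !gtn_eqF ?andbF // ltnW.
have ss : s \In slice b c 0.
  move=> k _ kb; rewrite !sE.
  have -> : (k == n) = false by apply/eqP => E; move: nb; rewrite -E kb eqxx.
  have -> : (k.+2 == n) = false.
    by apply/eqP => E; move: nb; rewrite -E /= negbK kb eqxx.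
  by rewrite andbF orbF; case: (c); rewrite /= ?mul1r ?mul0r.
exists (p - p`_n *: s).
  apply/lowP => k; rewrite leq_eqVlt => /orP[/eqP<-|nk].
    by rewrite coefB coefZ sE eqxx mulr1 subrr.
  rewrite coefB coefZ sE pn // gtn_eqF //= gtn_eqF ?andbF ?mulr0 ?subrr //.
  exact: ltnW.
exists (p`_n *: s); last by rewrite subrK.
by rewrite -[_ *: s]addr0; apply: subspace_lin => //; exact: subspace0.
Qed.

End Polynomials.

(** * Polynomials inside an infinite-dimensional space *)

Section Embedding.
Local Open Scope ring_scope.
Variables (K : fieldType) (V : lmodType K).

Lemma exists_independent_sequence : ~ finite_dimensional V ->
  exists x : nat -> V, forall n (c : nat -> K), x n <> \sum_(i < n) c i *: x i.
Proof.
move=> infV.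
have /choice[g gP] (s : seq V) : exists v, forall c : nat -> K,
    v <> \sum_(i < size s) c i *: s`_i.
  apply: contrapT => /forallNP h; apply: infV.
  exists (size s), (fun i => s`_i) => v; apply: contrapT => nv.
  by apply: (h v) => c vE; apply: nv; exists (fun i => c i).
pose s n := iter n (fun s => rcons s (g s)) [::].
have sE n : s n = mkseq (g \o s) n.
  by elim: n => // n IH; rewrite mkseqS -IH.
exists (g \o s) => n c /= E; have := gP (s n) c; rewrite {}E; apply.
by rewrite sE size_mkseq; apply: eq_bigr => i _; rewrite nth_mkseq.
Qed.

(** The basis ['X^i] goes to an independent sequence of [V]; working with
    polynomials gives access to coefficients although no basis of [V] is at
    hand. *)
Lemma exists_poly_embedding : ~ finite_dimensional V ->
  exists phi : {linear {poly K} -> V}, injective phi.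
Proof.
move=> /exists_independent_sequence[x xP].
pose f (p : {poly K}) := \sum_(i < size p) p`_i *: x i.
have fE n (p : {poly K}) : (size p <= n)%N -> f p = \sum_(i < n) p`_i *: x i.
  move=> pn; rewrite /f (big_ord_widen n (fun i => p`_i *: x i)) // big_mkcond.
  apply: eq_bigr => i _; case: ltnP => // ip.
  by rewrite nth_default // scale0r.
have f_lin : linear f.
  move=> a p q; pose n := maxn (size p) (size q).
  have pn : (size p <= n)%N by exact: leq_maxl.
  have qn : (size q <= n)%N by exact: leq_maxr.
  have sn : (size (a *: p + q)%R <= n)%N.
    rewrite (leq_trans (size_polyD _ _)) // geq_max qn andbT.
    exact: leq_trans (size_scale_leq _ _) pn.
  rewrite (fE n _ pn) (fE n _ qn) (fE n _ sn) scaler_sumr -big_split /=.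
  by apply: eq_bigr => i _; rewrite coefD coefZ scalerDl scalerA.
pose phi : {linear {poly K} -> V} :=
  HB.pack f (GRing.isLinear.Build K {poly K} V *:%R f f_lin).
exists phi; apply: raddf_inj => p /= fp0; apply/eqP/negP => /negP p0.
(* A relation expresses its last term by the previous ones. *)
have l0 : lead_coef p != 0 by rewrite lead_coef_eq0.
have sp : size p = (size p).-1.+1 by rewrite prednK // size_poly_gt0.
apply: (xP (size p).-1 (fun i => - (lead_coef p)^-1 * p`_i)).
move: fp0; rewrite /f sp big_ord_recr /=.
rewrite -[p`_(size p).-1]/(lead_coef p) => /eqP.
rewrite addrC addr_eq0 => /eqP E.
rewrite -[LHS]scale1r -(mulVf l0) -scalerA E scalerN -scaleNr scaler_sumr.
by apply: eq_bigr => i _; rewrite scalerA.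
Qed.

End Embedding.

(** * Images of subspaces *)

Section Image.
Local Open Scope ring_scope.
Variables (K : fieldType) (V : lmodType K).
Variable phi : {linear {poly K} -> V}.

Lemma subspace_image_subproof (U : subspace {poly K}) :
  `[< submod_closed [in phi @` U] >].
Proof.
apply/asboolP/subspace_closedP; split.
  by exists 0; [exact: subspace0|rewrite linear0].
move=> a _ _ [u Uu <-] [v Uv <-].
by exists (a *: u + v); [exact: subspace_lin|rewrite linearP].
Qed.

Definition subspace_image U := Subspace (subspace_image_subproof U).

Lemma subspace_image_mono U W :
  (U <= W)%O -> (subspace_image U <= subspace_image W)%O.
Proof.
by move=> /subspace_le h; apply/subspace_le => _ [u /h Wu <-]; exists u.
Qed.

Lemma subspace_image_add U W : subspace_image (Order.join U W) =
  Order.join (subspace_image U) (subspace_image W).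
Proof.
apply/le_anti/andP; split; last first.
  by rewrite leUx !subspace_image_mono ?leUl ?leUr.
apply/subspace_le => _ [_ [u Uu [w Ww <-]] <-].
exists (phi u); first by exists u.
by exists (phi w); [exists w|rewrite linearD].
Qed.

Hypothesis phi_inj : injective phi.

Lemma subspace_imageE U p : phi p \In subspace_image U <-> p \In U.
Proof. by split=> [[q Uq /phi_inj<-]|Up] //; exists p. Qed.

Lemma subspace_image_le U W :
  (subspace_image U <= subspace_image W)%O <-> (U <= W)%O.
Proof.
split; last exact: subspace_image_mono.
move=> /subspace_le h; apply/subspace_le => p.
by move=> /subspace_imageE/h/subspace_imageE.
Qed.

Lemma subspace_image_cap U W : subspace_image (Order.meet U W) =
  Order.meet (subspace_image U) (subspace_image W).
Proof.
apply/le_anti/andP; split.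
  by rewrite lexI !subspace_image_mono ?leIl ?leIr.
by apply/subspace_le => _ [[u Uu <-] /subspace_imageE Wu]; exists u.
Qed.

(** * The bi-ideal generated by the four spaces *)

(** The atoms number the four pairs [(b, c)] in binary.  The family [level a n]
    is, for fixed [a], a cofinal sequence in the row at [a] of the bi-ideal
    generated by the four spaces. *)
Definition level (a : M4) n : subspace V :=
  match a with
  | M4bot => \top%O
  | M4atom i => subspace_image (slice K (odd i) (1 < i)%N n)
  | M4top => subspace_image (low K n)
  end.

Lemma level_mono a n m : (n <= m)%N -> (level a n <= level a m)%O.
Proof.
case: a => [|i|] nm //=; apply: subspace_image_mono.
  exact: slice_mono.
exact: low_mono.
Qed.

Lemma level_anti a a' n : (a' <= a)%O -> (level a n <= level a' n)%O.
Proof.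
case: a a' => [|i|] [|j|] //=; rewrite ?lex1 //.
  by move=> /eqP->.
by move=> _; apply/subspace_image_mono/low_sub_slice.
Qed.

Lemma odd_gt1_inj (i j : 'I_4) :
  (odd i, 1 < i)%N = (odd j, 1 < j)%N -> i = j.
Proof.
by case: i j => [[|[|[|[|i]]]] hi] [[|[|[|[|j]]]] hj] //= _; apply: val_inj.
Qed.

(** Intersecting two rows costs one more step of the generation process, and
    nothing more: this is what makes the union over [n] a bi-ideal. *)
Lemma level_cap a a' n :
  (Order.meet (level a n) (level a' n) <= level (Order.join a a') n.+1)%O.
Proof.
have [le_aa'|nle_aa'] := boolP (a <= a')%O.
  by rewrite (join_r le_aa') (le_trans (leIr _ _)) // level_mono.
have [le_a'a|nle_a'a] := boolP (a' <= a)%O.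
  by rewrite (join_l le_a'a) (le_trans (leIl _ _)) // level_mono.
case: a a' nle_aa' nle_a'a => [|i|] [|j|] //= nij _.
have ne : (odd i, 1 < i)%N != (odd j, 1 < j)%N.
  by apply: contra nij => /eqP/odd_gt1_inj ->; rewrite lexx.
have -> : Order.join (M4atom i) (M4atom j) = M4top.
  by move: nij; rewrite /Order.le /Order.join /= => /negPf->.
rewrite -subspace_image_cap subspace_image_mono //.
by apply/subspace_le => p [pi pj]; exact: slice_cap ne pi pj.
Qed.

(** This bi-ideal bounds the one generated by the four spaces from above; it is
    in fact equal to it. *)
Definition level_set : set (M4 * subspace V) :=
  [set z | exists n, (z.2 <= level z.1 n)%O].

Lemma level_set_bi_ideal : is_bi_ideal level_set.
Proof.
split.
- move=> a a' W W' la lW [n /= Wn]; exists n => /=.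
  exact: le_trans lW (le_trans Wn (level_anti _ la)).
- by split=> x; exists 0%N; [exact: le0x|exact: lex1].
- move=> a0 a1 W [n /= Wn] [m /= Wm]; exists (maxn n m).+1 => /=.
  apply: le_trans (level_cap _ _ _); rewrite lexI.
  rewrite (le_trans Wn) ?(le_trans Wm) //; apply: level_mono.
    exact: leq_maxr.
  exact: leq_maxl.
- move=> a W0 W1 [n /= Wn] [m /= Wm]; exists (maxn n m) => /=.
  rewrite leUx (le_trans Wn) ?(le_trans Wm) //; apply: level_mono.
    exact: leq_maxr.
  exact: leq_maxl.
Qed.

Definition slices_span : bi_ideal M4 (subspace V) :=
  bi_span (range (fun i : 'I_4 => (M4atom i, level (M4atom i) 0))).

Lemma slices_span_compact : compact_element slices_span.
Proof. exact/bi_span_compact/finite_image/finite_finset. Qed.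

Lemma slices_span_le_level a W : (a, W) \In slices_span ->
  exists n, (W <= level a n)%O.
Proof.
apply: (_ : slices_span `<=` BiIdeal (asboolT level_set_bi_ideal)).
by apply/bi_ideal_le/bi_span_le => _ [i _ <-]; exists 0%N; exact: lexx.
Qed.

(** If [low n] is in the row at the top, it is in the row at both atoms of
    parity [~~ odd n], where it is added to the respective space.  Both sums
    contain [low n.+1], which therefore reaches the join of the two atoms, the
    top. *)
Lemma slices_span_low n : (\top%O, subspace_image (low K n)) \In slices_span.
Proof.
elim: n => [|n IH].
  suff -> : subspace_image (low K 0) = \bot%O.
    by have [_ [h _] _ _] := bi_ideal_spec slices_span.
  apply/le_anti/andP; split; last exact: le0x.
  apply/subspace_le => _ [p + <-] => /=.
  by rewrite size_poly_leq0 => /eqP->; rewrite linear0.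
have gen (c : bool) : (M4atom (inord (~~ odd n + c.*2)),
    subspace_image (low K n.+1)) \In slices_span.
  have lt4 : (~~ odd n + c.*2 < 4)%N by case: (odd n) (c) => [] [].
  apply: (@bi_ideal_down _ _ _ _ _ _ _ (Order.join (subspace_image (low K n))
     (level (M4atom (inord (~~ odd n + c.*2))) 0)) _ (lexx _)).
    rewrite /= -subspace_image_add subspace_image_mono // low_sub_add //.
    by rewrite inordK // oddD odd_double addbF; case: (odd n).
  apply: bi_ideal_joinr; last first.
    by apply: bi_span_sub; exists (inord (~~ odd n + c.*2)).
  exact: bi_ideal_down (lex1 _) (lexx _) IH.
have -> : \top%O = Order.join (M4atom (inord (~~ odd n + false.*2)))
    (M4atom (inord (~~ odd n + true.*2))) :> M4.
  rewrite /Order.join /= ifN // -val_eqE /= !inordK //; by case: (odd n).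
exact: bi_ideal_joinl.
Qed.

(** At the atom [ord0] the coefficients of even index at least [n] have to
    vanish, which excludes ['X^(n.*2)]. *)
Lemma tensor_not_lattice : ~ is_lattice (tensor M4 (subspace V)).
Proof.
move=> lat.
have atomP (x : M4) : (x <= M4atom ord0)%O -> x = \bot%O \/ x = M4atom ord0.
  by case: x => [|i|] //; [left|move=> /eqP->; right].
have [n hn] := @lattice_row_stable _ _ _ _ _ (M4atom ord0) _ _ lat
  slices_span_compact isT atomP (@lex1 _ _) (level_mono (M4atom ord0))
  (@slices_span_le_level (M4atom ord0)).
have : (subspace_image (low K n.*2.+1) <= level (M4atom ord0) n)%O.
  by apply: hn; apply: bi_ideal_down (lex1 _) (lexx _) (slices_span_low _).
move=> /subspace_image_le/subspace_le/(_ ('X^(n.*2))%R).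
rewrite /= size_polyXn leqnn => /(_ isT n.*2).
rewrite odd_double -addnn leq_addr mul0r coefXn eqxx => /(_ isT erefl)/eqP.
by rewrite oner_eq0.
Qed.

End Image.

Theorem theorem6 (K : fieldType) (V : lmodType K) :
  ~ finite_dimensional V -> ~ is_lattice (tensor M4 (subspace V)).
Proof. by move=> /exists_poly_embedding[phi /tensor_not_lattice]. Qed.
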